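(* Let $\{\eta,\xi\}\subset\mathbb{R}^3$ be orthonormal with $\eta\notin\mathrm{span}\{\mathbf{e}^1,\mathbf{e}^2\}$, and let $\chi\in\mathbb{R}^3$ be a unit vector such that $\chi$ and $\mathbf{e}^3$ are linearly independent. Let $\beta=(1+\chi_3,-\chi_2,\chi_1,0)$ and let $\alpha\in\mathbb{R}^4$ be a nonzero one of the two vectors $$\alpha^1=\big(\eta_2-\xi_1,\ \eta_2\xi_3-\xi_2\eta_3+\eta_3,\ \xi_1\eta_3-\xi_3\eta_1+\xi_3,\ 1-\eta_2\xi_1+\xi_2\eta_1-\xi_2-\eta_1\big),$$ $$\alpha^2=\big(\eta_2\xi_3-\xi_2\eta_3-\eta_3,\ \eta_2+\xi_1,\ 1+\eta_2\xi_1-\xi_2\eta_1+\xi_2-\eta_1,\ \xi_1\eta_3-\xi_3\eta_1+\xi_3\big).$$ In the polynomial ring $\mathbb{R}[a,b]=\mathbb{R}[a_0,\dots,a_3,b_0,\dots,b_3]$ consider the ideal $$I_{ab}=\big\langle \langle R(a)\eta,R(b)\chi\rangle,\ \langle R(a)\xi,R(b)\chi\rangle,\ |a|^2-1,\ |b|^2-1\big\rangle .$$ Put $u=\frac{1}{|\alpha|}K(a)^T\alpha$ and $z=\frac{1}{|\beta|}K(b)^T\beta$ (vectors of linear forms in $a$ and in $b$ respectively), and for $j=1,2$ let $I_{ab}^j\subset\mathbb{R}[a,b]$ be the ideal generated by $|a|^2-1$, $|b|^2-1$ and the five polynomials $k^j_1,\dots,k^j_5$ (listed in the context) evaluated at these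 $u,z$. Then $I_{ab}^1$ and $I_{ab}^2$ are prime ideals and $$I_{ab}=I_{ab}^1\cap I_{ab}^2 .$$ In particular $I_{ab}$ is not prime.
   Context: Vectors in $\mathbb{R}^4$ (or with polynomial entries) are indexed $a=(a_0,a_1,a_2,a_3)$; vectors in $\mathbb{R}^3$ are indexed $1,2,3$; $\mathbf{e}^j$ are the standard unit vectors of $\mathbb{R}^3$; $\langle\cdot,\cdot\rangle$ with two vector arguments is the standard inner product (extended bilinearly to polynomial entries) and otherwise $\langle\dots\rangle$ denotes the ideal generated; $|a|^2=a_0^2+a_1^2+a_2^2+a_3^2$. $$R(a)=\begin{pmatrix} a_0^2+a_1^2-a_2^2-a_3^2 & 2a_1a_2-2a_0a_3 & 2a_1a_3+2a_0a_2\\ 2a_1a_2+2a_0a_3 & a_0^2-a_1^2+a_2^2-a_3^2 & 2a_2a_3-2a_0a_1\\ 2a_1a_3-2a_0a_2 & 2a_2a_3+2a_0a_1 & a_0^2-a_1^2-a_2^2+a_3^2\end{pmatrix},$$ $$K(a)=\begin{pmatrix} a_0&a_1&a_2&a_3\\ -a_1&a_0&a_3&-a_2\\ -a_2&-a_3&a_0&a_1\\ -a_3&a_2&-a_1&a_0\end{pmatrix}.$$ The polynomials $k^j_m$ in $u=(u_0,\dots,u_3)$, $z=(z_0,\dots,z_3)$ are: $k^1_1=z_1u_3+z_0u_2-z_3u_1-z_2u_0$, $k^1_2=z_2u_3-z_3u_2-z_0u_1+z_1u_0$, $k^1_3=z_3z_1+z_2z_0-u_3u_1-u_2u_0$, $k^1_4=z_3z_2-z_1z_0-u_3u_2+u_1u_0$,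 $k^1_5=z_2^2+z_1^2-u_2^2-u_1^2$; $k^2_1=z_0u_3-z_1u_2+z_2u_1-z_3u_0$, $k^2_2=z_3u_3+z_2u_2+z_1u_1+z_0u_0$, $k^2_3=z_3z_1+z_2z_0+u_3u_1+u_2u_0$, $k^2_4=z_3z_2-z_1z_0+u_3u_2-u_1u_0$, $k^2_5=z_3^2+z_0^2-u_2^2-u_1^2$. *)

(* Defs.v *)
From mathcomp Require Import all_boot all_order all_algebra ring_quotient.
From mathcomp Require Import boolp reals.
From mathcomp Require Import mpoly.

Set Implicit Arguments.
Unset Strict Implicit.
Unset Printing Implicit Defensive.

Import GRing.Theory Num.Theory.
Local Open Scope ring_scope.

(* Vectors are columns, with indices starting at 0.  So the components 0,..,3
   of a vector of length 4 keep their usual numbers, while the components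
   1, 2, 3 of a vector v of length 3 are v 0 0, v 1 0 and v 2 0,
   and the standard unit vectors e^1, e^2, e^3 are evec 0, evec 1, evec 2. *)

Section Ideals.
Variable A : comNzRingType.

Definition ideal_gen (s : seq A) : {pred A} :=
  [pred p | `[< exists c : 'I_(size s) -> A, p = \sum_(i < size s) c i * s`_i >]].

(* idealr_closed S already includes 1 \notin S. *)
Definition prime_ideal (S : {pred A}) : Prop :=
  idealr_closed S /\ prime_idealr_closed S.
End Ideals.

Section Vectors.
Variable A : comNzRingType.

Definition dotp n (v w : 'cV[A]_n) : A := \sum_(i < n) v i 0 * w i 0.

Definition col_of (n : nat) (s : seq A) : 'cV[A]_n := \col_(i < n) s`_i.

Definition mx_of_rows (m n : nat) (rows : seq (seq A)) : 'M[A]_(m, n) :=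
  \matrix_(i < m, j < n) (nth [::] rows i)`_j.

Definition Rmx (a : 'cV[A]_4) : 'M[A]_3 :=
  let a0 := a 0 0 in let a1 := a 1 0 in let a2 := a 2 0 in let a3 := a 3 0 in
  mx_of_rows 3 3 [::
    [:: a0 ^+ 2 + a1 ^+ 2 - a2 ^+ 2 - a3 ^+ 2;
        2 * a1 * a2 - 2 * a0 * a3;
        2 * a1 * a3 + 2 * a0 * a2];
    [:: 2 * a1 * a2 + 2 * a0 * a3;
        a0 ^+ 2 - a1 ^+ 2 + a2 ^+ 2 - a3 ^+ 2;
        2 * a2 * a3 - 2 * a0 * a1];
    [:: 2 * a1 * a3 - 2 * a0 * a2;
        2 * a2 * a3 + 2 * a0 * a1;
        a0 ^+ 2 - a1 ^+ 2 - a2 ^+ 2 + a3 ^+ 2]].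

Definition Kmx (a : 'cV[A]_4) : 'M[A]_4 :=
  let a0 := a 0 0 in let a1 := a 1 0 in let a2 := a 2 0 in let a3 := a 3 0 in
  mx_of_rows 4 4 [::
    [::   a0;   a1;   a2;   a3];
    [:: - a1;   a0;   a3; - a2];
    [:: - a2; - a3;   a0;   a1];
    [:: - a3;   a2; - a1;   a0]].

Definition k1 (u z : 'cV[A]_4) : seq A :=
  let u0 := u 0 0 in let u1 := u 1 0 in let u2 := u 2 0 in let u3 := u 3 0 in
  let z0 := z 0 0 in let z1 := z 1 0 in let z2 := z 2 0 in let z3 := z 3 0 in
  [:: z1 * u3 + z0 * u2 - z3 * u1 - z2 * u0;
      z2 * u3 - z3 * u2 - z0 * u1 + z1 * u0;
      z3 * z1 + z2 * z0 - u3 * u1 - u2 * u0;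
      z3 * z2 - z1 * z0 - u3 * u2 + u1 * u0;
      z2 ^+ 2 + z1 ^+ 2 - u2 ^+ 2 - u1 ^+ 2].

Definition k2 (u z : 'cV[A]_4) : seq A :=
  let u0 := u 0 0 in let u1 := u 1 0 in let u2 := u 2 0 in let u3 := u 3 0 in
  let z0 := z 0 0 in let z1 := z 1 0 in let z2 := z 2 0 in let z3 := z 3 0 in
  [:: z0 * u3 - z1 * u2 + z2 * u1 - z3 * u0;
      z3 * u3 + z2 * u2 + z1 * u1 + z0 * u0;
      z3 * z1 + z2 * z0 + u3 * u1 + u2 * u0;
      z3 * z2 - z1 * z0 + u3 * u2 - u1 * u0;
      z3 ^+ 2 + z0 ^+ 2 - u2 ^+ 2 - u1 ^+ 2].

Definition alpha1 (eta xi : 'cV[A]_3) : 'cV[A]_4 :=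
  let h1 := eta 0 0 in let h2 := eta 1 0 in let h3 := eta 2 0 in
  let x1 := xi 0 0 in let x2 := xi 1 0 in let x3 := xi 2 0 in
  col_of 4 [:: h2 - x1;
               h2 * x3 - x2 * h3 + h3;
               x1 * h3 - x3 * h1 + x3;
               1 - h2 * x1 + x2 * h1 - x2 - h1].

Definition alpha2 (eta xi : 'cV[A]_3) : 'cV[A]_4 :=
  let h1 := eta 0 0 in let h2 := eta 1 0 in let h3 := eta 2 0 in
  let x1 := xi 0 0 in let x2 := xi 1 0 in let x3 := xi 2 0 in
  col_of 4 [:: h2 * x3 - x2 * h3 - h3;
               h2 + x1;
               1 + h2 * x1 - x2 * h1 + x2 - h1;
               x1 * h3 - x3 * h1 + x3].

Definition beta (chi : 'cV[A]_3) : 'cV[A]_4 :=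
  let c1 := chi 0 0 in let c2 := chi 1 0 in let c3 := chi 2 0 in
  col_of 4 [:: 1 + c3; - c2; c1; 0].
End Vectors.

Section Polynomials.
Variable R : realType.

Definition evec (j : 'I_3) : 'cV[R]_3 := delta_mx j 0.

Definition orthonormal2 (v w : 'cV[R]_3) : Prop :=
  [/\ dotp v v = 1, dotp w w = 1 & dotp v w = 0].

(* R[a, b]: the first four variables are a_0, .., a_3, the last four are
   b_0, .., b_3. *)
Local Notation Rab := {mpoly R[4 + 4]}.

Definition avar : 'cV[Rab]_4 := \col_(i < 4) 'X_(lshift 4 i).
Definition bvar : 'cV[Rab]_4 := \col_(i < 4) 'X_(rshift 4 i).

Definition constv n (v : 'cV[R]_n) : 'cV[Rab]_n :=
  \col_(i < n) (v i 0)%:MP.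

(* |c|^-1 K(v)^T c *)
Definition linforms (v : 'cV[Rab]_4) (c : 'cV[R]_4) : 'cV[Rab]_4 :=
  ((Num.sqrt (dotp c c))^-1)%:MP *: ((Kmx v)^T *m constv c).

Definition Iab (eta xi chi : 'cV[R]_3) : {pred Rab} :=
  ideal_gen [:: dotp (Rmx avar *m constv eta) (Rmx bvar *m constv chi);
                dotp (Rmx avar *m constv xi) (Rmx bvar *m constv chi);
                dotp avar avar - 1;
                dotp bvar bvar - 1].

Definition Iab1 (alpha : 'cV[R]_4) (chi : 'cV[R]_3) : {pred Rab} :=
  ideal_gen [:: dotp avar avar - 1, dotp bvar bvar - 1
              & k1 (linforms avar alpha) (linforms bvar (beta chi))].

Definition Iab2 (alpha : 'cV[R]_4) (chi : 'cV[R]_3) : {pred Rab} :=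
  ideal_gen [:: dotp avar avar - 1, dotp bvar bvar - 1
              & k2 (linforms avar alpha) (linforms bvar (beta chi))].
End Polynomials.

(* Main.v *)
(* Read vectors of length 4 as quaternions and put W = u^* z.  As
   u = a alpha/|alpha| and z = b beta/|beta|, where alpha and beta rotate e^1,
   e^2 to eta, xi and e^3 to chi, the first two generators of Iab are the
   components 1 and 2 of
   R(W) e^3, i.e. 2 (W1 W3 + W0 W2) and 2 (W2 W3 - W0 W1), while modulo the
   norm equations the polynomials k^1 (k^2) generate the same ideal as W1, W2
   (W0, W3).  Since W0^2 + W1^2 + W2^2 + W3^2 = 1, the two ideals are
   comaximal, and Iab contains the products of their generators, so Iab is
   their intersection; it contains W0 W1 but neither W0 nor W1.

   A linear automorphism of R[a, b] reduces primality to the case of the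
   ideal (|a|^2 - 1, |b|^2 - 1, W1, W2) with W = a^* b.  It is the vanishing
   ideal of the real points (x, x (c + s k)), |x| = 1, c^2 + s^2 = 1: modulo it
   every polynomial is A + B a0 + C W0 + D a0 W0 with A, B, C, D in
   R[a1, a2, a3, W3], and these vanish by changing the signs of a0 and W0.
   This set is irreducible because it is parametrised by
   x = y^2 / |y|^2, c + s k = v^2 / |v|^2. *)

Require Import Defs.
From mathcomp Require Import all_boot all_order all_algebra ring_quotient.
From mathcomp Require Import boolp reals.
From mathcomp Require Import mpoly.
From mathcomp Require Import ring lra.

Set Implicit Arguments.
Unset Strict Implicit.
Unset Printing Implicit Defensive.

Import Order.TTheory GRing.Theory Num.Theory.
Local Open Scope ring_scope.

(** * Generated ideals *)

Section Ideals.
Variable A : comNzRingType.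
Implicit Types (s t : seq A) (p q : A).

Lemma ideal_genP s p :
  reflect (exists c : 'I_(size s) -> A, p = \sum_(i < size s) c i * s`_i)
          (p \in ideal_gen s).
Proof. by rewrite inE; apply: asboolP. Qed.

Lemma ideal_gen0 s : 0 \in ideal_gen s.
Proof.
by apply/ideal_genP; exists (fun=> 0); rewrite big1 // => i _; rewrite mul0r.
Qed.

Lemma ideal_genMD s c p q :
  p \in ideal_gen s -> q \in ideal_gen s -> c * p + q \in ideal_gen s.
Proof.
move=> /ideal_genP[a ->] /ideal_genP[b ->].
apply/ideal_genP; exists (fun i => c * a i + b i).
by rewrite mulr_sumr -big_split; apply: eq_bigr => i _; rewrite mulrDl mulrA.
Qed.

Lemma ideal_genM s c p : p \in ideal_gen s -> c * p \in ideal_gen s.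
Proof. by move=> ps; rewrite -[_ * _]addr0 ideal_genMD ?ideal_gen0. Qed.

Lemma ideal_genD s p q :
  p \in ideal_gen s -> q \in ideal_gen s -> p + q \in ideal_gen s.
Proof. by move=> ps qs; rewrite -[p]mul1r ideal_genMD. Qed.

Lemma ideal_genB s p q :
  p \in ideal_gen s -> q \in ideal_gen s -> p - q \in ideal_gen s.
Proof. by move=> ps qs; rewrite addrC -mulN1r ideal_genMD. Qed.

Lemma mem_ideal_gen s p : p \in s -> p \in ideal_gen s.
Proof.
move=> ps; apply/ideal_genP.
have ip : (index p s < size s)%N by rewrite index_mem.
exists (fun i => (i == Ordinal ip)%:R).
rewrite (bigD1 (Ordinal ip)) //= eqxx mul1r nth_index // big1 ?addr0 //.
by move=> i /negPf->; rewrite mul0r.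
Qed.

Lemma ideal_gen_ind s (P : A -> Prop) :
    P 0 -> (forall c g p, g \in s -> P p -> P (c * g + p)) ->
  forall p, p \in ideal_gen s -> P p.
Proof.
move=> P0 PD p /ideal_genP[c ->].
by apply: (big_rec P) => // i x _; apply: PD; apply: mem_nth.
Qed.

Lemma ideal_gen_sub s t :
    (forall g, g \in s -> g \in ideal_gen t) ->
  forall p, p \in ideal_gen s -> p \in ideal_gen t.
Proof.
move=> st; apply: (ideal_gen_ind (P := fun p => p \in ideal_gen t)).
  exact: ideal_gen0.
by move=> c g p /st gt pt; apply: ideal_genMD.
Qed.

Lemma ideal_gen_eq s t :
    (forall g, g \in s -> g \in ideal_gen t) ->
    (forall g, g \in t -> g \in ideal_gen s) ->
  ideal_gen s =i ideal_gen t.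
Proof. by move=> st ts p; apply/idP/idP; apply: ideal_gen_sub. Qed.

(** Listing the cofactors turns a membership into a single ring identity. *)
Lemma ideal_gen_comb (cs : seq A) s p :
  p = \sum_(x <- zip cs s) x.1 * x.2 -> p \in ideal_gen s.
Proof.
move=> ->.
suff: forall s' cs', {subset s' <= s} ->
    \sum_(x <- zip cs' s') x.1 * x.2 \in ideal_gen s by apply.
elim=> [|g s' IHs] [|c cs'] s's /=; rewrite ?big_nil ?ideal_gen0 //.
rewrite big_cons; apply: ideal_genMD.
  by apply: mem_ideal_gen; rewrite s's ?mem_head.
by apply: IHs => x xs; rewrite s's // in_cons xs orbT.
Qed.
Lemma ideal_gen_mull s t (h p : A) :
    (forall g, g \in s -> h * g \in ideal_gen t) ->
  p \in ideal_gen s -> h * p \in ideal_gen t.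
Proof.
move=> hs; move: p.
apply: (ideal_gen_ind (P := fun p => h * p \in ideal_gen t)).
  by rewrite mulr0 ideal_gen0.
by move=> c g p /hs gt pt; rewrite mulrDr mulrCA ideal_genMD.
Qed.

End Ideals.

Lemma sum_ord4 (V : nmodType) (F : 'I_4 -> V) :
  \sum_(i < 4) F i = F 0 + F 1 + F 2 + F 3.
Proof.
rewrite !big_ord_recl big_ord0 addr0 !addrA.
by congr (_ + _ + _ + _); congr F; apply: val_inj.
Qed.

Lemma sum_ord3 (V : nmodType) (F : 'I_3 -> V) :
  \sum_(i < 3) F i = F 0 + F 1 + F 2.
Proof.
rewrite !big_ord_recl big_ord0 addr0 !addrA.
by congr (_ + _ + _); congr F; apply: val_inj.
Qed.

Lemma forall_ord4 (P : 'I_4 -> Prop) : P 0 -> P 1 -> P 2 -> P 3 -> forall i, P i.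
Proof.
move=> P0 P1 P2 P3 [[|[|[|[|//]]]] i_lt].
- by rewrite (_ : Ordinal i_lt = 0) //; apply: val_inj.
- by rewrite (_ : Ordinal i_lt = 1) //; apply: val_inj.
- by rewrite (_ : Ordinal i_lt = 2) //; apply: val_inj.
- by rewrite (_ : Ordinal i_lt = 3) //; apply: val_inj.
Qed.

Lemma forall_ord3 (P : 'I_3 -> Prop) : P 0 -> P 1 -> P 2 -> forall i, P i.
Proof.
move=> P0 P1 P2 [[|[|[|//]]] i_lt].
- by rewrite (_ : Ordinal i_lt = 0) //; apply: val_inj.
- by rewrite (_ : Ordinal i_lt = 1) //; apply: val_inj.
- by rewrite (_ : Ordinal i_lt = 2) //; apply: val_inj.
Qed.

(** * Quaternions *)

Section Quaternions.
Variable A : comNzRingType.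
Implicit Types p q : 'cV[A]_4.

Definition quat (x0 x1 x2 x3 : A) : 'cV[A]_4 := col_of 4 [:: x0; x1; x2; x3].

Lemma quatE x0 x1 x2 x3 :
  ((quat x0 x1 x2 x3 0 0 = x0) * (quat x0 x1 x2 x3 1 0 = x1) *
   (quat x0 x1 x2 x3 2 0 = x2) * (quat x0 x1 x2 x3 3 0 = x3))%type.
Proof. by rewrite !mxE. Qed.

Lemma quat_eqP p q :
    p 0 0 = q 0 0 -> p 1 0 = q 1 0 -> p 2 0 = q 2 0 -> p 3 0 = q 3 0 -> p = q.
Proof.
by move=> e0 e1 e2 e3; apply/colP; apply: forall_ord4.
Qed.

(** The Hamilton product: K(p)^T is the matrix of left multiplication by p. *)
Definition qmul p q : 'cV[A]_4 := (Kmx p)^T *m q.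

Lemma qmulE p q :
  ((qmul p q 0 0 = (p 0 0 * q 0 0 - p 1 0 * q 1 0 - p 2 0 * q 2 0 - p 3 0 * q 3 0)%R) *
   (qmul p q 1 0 = (p 0 0 * q 1 0 + p 1 0 * q 0 0 + p 2 0 * q 3 0 - p 3 0 * q 2 0)%R) *
   (qmul p q 2 0 = (p 0 0 * q 2 0 - p 1 0 * q 3 0 + p 2 0 * q 0 0 + p 3 0 * q 1 0)%R) *
   (qmul p q 3 0 = (p 0 0 * q 3 0 + p 1 0 * q 2 0 - p 2 0 * q 1 0 + p 3 0 * q 0 0)%R))%type.
Proof. by do !split; rewrite !mxE sum_ord4 !mxE /=; ring. Qed.

Definition qconj p : 'cV[A]_4 := quat (p 0 0) (- p 1 0) (- p 2 0) (- p 3 0).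

Lemma dotp4E p q :
  dotp p q = p 0 0 * q 0 0 + p 1 0 * q 1 0 + p 2 0 * q 2 0 + p 3 0 * q 3 0.
Proof. exact: sum_ord4. Qed.

Lemma dotp3E (v w : 'cV[A]_3) :
  dotp v w = v 0 0 * w 0 0 + v 1 0 * w 1 0 + v 2 0 * w 2 0.
Proof. exact: sum_ord3. Qed.

Definition qE := (qmulE, quatE, dotp4E).

Lemma qmulA p q r : qmul p (qmul q r) = qmul (qmul p q) r.
Proof. by apply: quat_eqP; rewrite !qE; ring. Qed.

Lemma qmul_conj p : qmul p (qconj p) = quat (dotp p p) 0 0 0.
Proof. by apply: quat_eqP; rewrite !qE; ring. Qed.

Lemma qmul_scalar p c : qmul p (quat c 0 0 0) = c *: p.
Proof. by apply: quat_eqP; rewrite !qE mxE; ring. Qed.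

Lemma dotp_qmul p q : dotp (qmul p q) (qmul p q) = dotp p p * dotp q q.
Proof. by rewrite !qE; ring. Qed.

Lemma RmxE p :
  let a0 := p 0 0 in let a1 := p 1 0 in let a2 := p 2 0 in let a3 := p 3 0 in
  ((Rmx p 0 0 = (a0 ^+ 2 + a1 ^+ 2 - a2 ^+ 2 - a3 ^+ 2)%R) *
   (Rmx p 0 1 = (2 * a1 * a2 - 2 * a0 * a3)%R) *
   (Rmx p 0 2 = (2 * a1 * a3 + 2 * a0 * a2)%R) *
   (Rmx p 1 0 = (2 * a1 * a2 + 2 * a0 * a3)%R) *
   (Rmx p 1 1 = (a0 ^+ 2 - a1 ^+ 2 + a2 ^+ 2 - a3 ^+ 2)%R) *
   (Rmx p 1 2 = (2 * a2 * a3 - 2 * a0 * a1)%R) *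
   (Rmx p 2 0 = (2 * a1 * a3 - 2 * a0 * a2)%R) *
   (Rmx p 2 1 = (2 * a2 * a3 + 2 * a0 * a1)%R) *
   (Rmx p 2 2 = (a0 ^+ 2 - a1 ^+ 2 - a2 ^+ 2 + a3 ^+ 2)%R))%type.
Proof. by rewrite /= !mxE. Qed.

Lemma Rmx_qmul p q : Rmx (qmul p q) = Rmx p *m Rmx q.
Proof.
apply/matrixP.
by do 2!apply: forall_ord3; rewrite [RHS]mxE sum_ord3 !RmxE !qE; ring.
Qed.

Lemma Rmx_qconj p : Rmx (qconj p) = (Rmx p)^T.
Proof.
apply/matrixP.
by do 2!apply: forall_ord3; rewrite [RHS]mxE !RmxE !qE; ring.
Qed.

Lemma dotp_mulmx (n : nat) (M N : 'M[A]_n) (v w : 'cV[A]_n) :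
  dotp (M *m v) (N *m w) = dotp v (M^T *m N *m w).
Proof.
have dotpE (x y : 'cV[A]_n) : dotp x y = (x^T *m y) 0 0.
  by rewrite mxE; apply: eq_bigr => i _; rewrite mxE.
by rewrite !dotpE trmx_mul !mulmxA.
Qed.

(** Conjugation transposes R, so R(p)^T R(q) is the single matrix R(p^* q). *)
Lemma dotp_Rmx p q (v w : 'cV[A]_3) :
  dotp (Rmx p *m v) (Rmx q *m w) = dotp v (Rmx (qmul (qconj p) q) *m w).
Proof. by rewrite dotp_mulmx Rmx_qmul Rmx_qconj. Qed.

End Quaternions.

(** * Ideals generated by components of W = u^* z *)

Ltac ideal_comb cs :=
  apply: (ideal_gen_comb (cs := cs)); rewrite /= !big_cons big_nil /=.
Ltac by_gens :=
  move=> ?; rewrite /= !in_cons in_nil orbF; do ?[case/orP]; move/eqP->.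

Lemma eq_mem_predI (T : Type) (S A B A' B' : {pred T}) :
  S =i [predI A & B] -> A' =i A -> B' =i B -> S =i [predI A' & B'].
Proof. by move=> SE AE BE x; rewrite SE !inE AE BE. Qed.

Section Generators.
Variable A : comNzRingType.
Variables u z : 'cV[A]_4.
Local Notation W := (qmul (qconj u) z).

Definition gens12 : seq A := [:: dotp u u - 1; dotp z z - 1; W 1 0; W 2 0].
Definition gens03 : seq A := [:: dotp u u - 1; dotp z z - 1; W 0 0; W 3 0].
(* The first two entries are the components 1 and 2 of R(W) e^3, hence
   <R(u) e^j, R(z) e^3> for j = 1, 2. *)
Definition gens_cap : seq A :=
  [:: Rmx W 0 2; Rmx W 1 2; dotp u u - 1; dotp z z - 1].

(** The first two k^1 are - W2 and W1. The other three compare R(u) e^3 with R(z) e^3, which agree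
    modulo the norm equations when W1 = W2 = 0, since R(W) then fixes e^3. *)
Lemma ideal_k1 :
  ideal_gen [:: dotp u u - 1, dotp z z - 1 & k1 u z]
  =i ideal_gen gens12.
Proof.
pose n := dotp u u; pose m := dotp z z.
apply: ideal_gen_eq; by_gens; try by apply: mem_ideal_gen; rewrite !inE eqxx ?orbT.
- by ideal_comb [:: 0; 0; 0; -1 : A]; rewrite !qE; ring.
- by ideal_comb [:: 0; 0; 1; 0 : A]; rewrite !qE; ring.
(* The cofactors come from R(u) R(W) e^3 = n^2 R(z) e^3, a consequence of u W = n z. Here h and g
   are half the first entries of R(u) e^3 and R(z) e^3; the cofactor - (n + 1) g trades n^2 g for g,
   and the terms h m and h trade n m h for h. *)
- pose h := u 1 0 * u 3 0 + u 0 0 * u 2 0; pose R := Rmx u.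
  pose g := z 1 0 * z 3 0 + z 0 0 * z 2 0.
  ideal_comb [:: - (n + 1) * g + h * m; h;
       R 0 0 * W 3 0 - R 0 1 * W 0 0 - 2 * h * W 1 0;
       R 0 0 * W 0 0 + R 0 1 * W 3 0 - 2 * h * W 2 0].
  by rewrite /n /m /h /R /g !RmxE !qE; ring.
- pose h := u 2 0 * u 3 0 - u 0 0 * u 1 0; pose R := Rmx u.
  pose g := z 2 0 * z 3 0 - z 0 0 * z 1 0.
  ideal_comb [:: - (n + 1) * g + h * m; h;
       R 1 0 * W 3 0 - R 1 1 * W 0 0 - 2 * h * W 1 0;
       R 1 0 * W 0 0 + R 1 1 * W 3 0 - 2 * h * W 2 0].
  by rewrite /n /m /h /R /g !RmxE !qE; ring.
(* Now h and g come from the third entries n - 2 h and m - 2 g of R(u) e^3 and R(z) e^3. *)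
- pose h := u 1 0 ^+ 2 + u 2 0 ^+ 2; pose R := Rmx u.
  pose g := z 1 0 ^+ 2 + z 2 0 ^+ 2.
  ideal_comb [:: - (n + 1) * g + h * m; h;
       - R 2 0 * W 3 0 + R 2 1 * W 0 0 + R 2 2 * W 1 0;
       - R 2 0 * W 0 0 - R 2 1 * W 3 0 + R 2 2 * W 2 0].
  by rewrite /n /m /h /R /g !RmxE !qE; ring.
- by ideal_comb [:: 0; 0; 0; 1; 0; 0; 0 : A]; rewrite !qE; ring.
- by ideal_comb [:: 0; 0; -1; 0; 0; 0; 0 : A]; rewrite !qE; ring.
Qed.

(** When W0 = W3 = 0, the rotation R(W) sends e^3 to - e^3 modulo the norm equations, so R(u) e^3
    and R(z) e^3 are opposite. The cofactors are found as in [ideal_k1]. *)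
Lemma ideal_k2 :
  ideal_gen [:: dotp u u - 1, dotp z z - 1 & k2 u z]
  =i ideal_gen gens03.
Proof.
pose n := dotp u u; pose m := dotp z z.
apply: ideal_gen_eq; by_gens; try by apply: mem_ideal_gen; rewrite !inE eqxx ?orbT.
- by ideal_comb [:: 0; 0; 0; -1 : A]; rewrite !qE; ring.
- by ideal_comb [:: 0; 0; 1; 0 : A]; rewrite !qE; ring.
- pose h := u 1 0 * u 3 0 + u 0 0 * u 2 0; pose R := Rmx u.
  pose g := z 1 0 * z 3 0 + z 0 0 * z 2 0.
  ideal_comb [:: - (n + 1) * g - h * m; - h;
       R 0 0 * W 2 0 - R 0 1 * W 1 0 + 2 * h * W 0 0;
       R 0 0 * W 1 0 + R 0 1 * W 2 0 + 2 * h * W 3 0].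
  by rewrite /n /m /h /R /g !RmxE !qE; ring.
- pose h := u 2 0 * u 3 0 - u 0 0 * u 1 0; pose R := Rmx u.
  pose g := z 2 0 * z 3 0 - z 0 0 * z 1 0.
  ideal_comb [:: - (n + 1) * g - h * m; - h;
       R 1 0 * W 2 0 - R 1 1 * W 1 0 + 2 * h * W 0 0;
       R 1 0 * W 1 0 + R 1 1 * W 2 0 + 2 * h * W 3 0].
  by rewrite /n /m /h /R /g !RmxE !qE; ring.
- pose h := u 1 0 ^+ 2 + u 2 0 ^+ 2; pose R := Rmx u.
  pose g := z 0 0 ^+ 2 + z 3 0 ^+ 2.
  ideal_comb [:: - (n + 1) * g + h * m; h;
       R 2 0 * W 2 0 - R 2 1 * W 1 0 + R 2 2 * W 0 0;
       R 2 0 * W 1 0 + R 2 1 * W 2 0 + R 2 2 * W 3 0].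
  by rewrite /n /m /h /R /g !RmxE !qE; ring.
- by ideal_comb [:: 0; 0; 0; 1; 0; 0; 0 : A]; rewrite !qE; ring.
- by ideal_comb [:: 0; 0; -1; 0; 0; 0; 0 : A]; rewrite !qE; ring.
Qed.

Variables (half : A) (half2 : half * 2 = 1).
Let n := dotp u u.
Let m := dotp z z.
Let I := ideal_gen gens_cap.

Lemma dotp_W : n * m = W 0 0 ^+ 2 + W 1 0 ^+ 2 + W 2 0 ^+ 2 + W 3 0 ^+ 2.
Proof. by rewrite /n /m !qE; ring. Qed.

(* With P = w2 + i w1 and Q = w0 + i w3 the first two generators are the real
   and imaginary parts of 2 P Q^*, and
   P Q (|P|^2 + |Q|^2) = P^2 (P^* Q) + Q^2 (P Q^* ) with |P|^2 + |Q|^2 = 1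
   modulo the last two, so that P Q vanishes as well. *)
Lemma mem_W_mul :
  [/\ W 0 0 * W 1 0 \in I, W 0 0 * W 2 0 \in I,
      W 3 0 * W 1 0 \in I & W 3 0 * W 2 0 \in I].
Proof.
have := dotp_W; rewrite /I /gens_cap !RmxE /n /m.
move: (W 0 0) (W 1 0) (W 2 0) (W 3 0) (dotp u u) (dotp z z) => w0 w1 w2 w3 a b ab.
set J := ideal_gen _.
have hh p : p = half * (2 * p) by rewrite mulrA half2 mul1r.
have hX : w1 * w3 + w0 * w2 \in J.
  by rewrite [X in X \in _]hh; ideal_comb [:: half; 0; 0; 0]; ring.
have hY : w2 * w3 - w0 * w1 \in J.
  by rewrite [X in X \in _]hh; ideal_comb [:: 0; half; 0; 0]; ring.
have hN q : q * (a * b - 1) \in J.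
  by ideal_comb [:: 0; 0; q * b; q]; ring.
(* [hD1] and [hD2] are the real and imaginary parts of P Q, and a b is |P|^2 + |Q|^2. *)
have hD1 : w0 * w2 - w1 * w3 \in J.
  rewrite [X in X \in _](_ : _ =
    (w2 ^+ 2 - w1 ^+ 2 + w0 ^+ 2 - w3 ^+ 2) * (w1 * w3 + w0 * w2)
    + (2 * (w0 * w3 - w1 * w2) * (w2 * w3 - w0 * w1)
    - (w0 * w2 - w1 * w3) * (a * b - 1))); last by rewrite ab; ring.
  by apply: ideal_genMD => //; apply: ideal_genB => //; apply: ideal_genM.
have hD2 : w2 * w3 + w0 * w1 \in J.
  rewrite [X in X \in _](_ : _ =
    (w2 ^+ 2 - w1 ^+ 2 - w0 ^+ 2 + w3 ^+ 2) * (w2 * w3 - w0 * w1)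
    + (2 * (w0 * w3 + w1 * w2) * (w1 * w3 + w0 * w2)
    - (w2 * w3 + w0 * w1) * (a * b - 1))); last by rewrite ab; ring.
  by apply: ideal_genMD => //; apply: ideal_genB => //; apply: ideal_genM.
have hhalf x y p : x \in J -> y \in J -> 2 * p = x + y -> p \in J.
  move=> xJ yJ pE; rewrite (_ : p = half * (x + y)).
    by rewrite ideal_genM ?ideal_genD.
  by rewrite -pE -hh.
(* The four products are half sums or half differences of parts of P Q^* and P Q. *)
split.
- by apply: (hhalf _ (- 1 * (w2 * w3 - w0 * w1)) _ hD2); [exact: ideal_genM|ring].
- by apply: (hhalf _ _ _ hX hD1); ring.
- by apply: (hhalf _ (- 1 * (w0 * w2 - w1 * w3)) _ hX); [exact: ideal_genM|ring].
- by apply: (hhalf _ _ _ hY hD2); ring.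
Qed.

Lemma ideal_cap :
  ideal_gen gens_cap =i [predI ideal_gen gens12 & ideal_gen gens03].
Proof.
move=> x; rewrite inE; apply/idP/andP.
  move=> xI; split; move: x xI; rewrite /gens_cap !RmxE;
    apply: ideal_gen_sub; by_gens;
    try by apply: mem_ideal_gen; rewrite !inE eqxx ?orbT.
  - by ideal_comb [:: 0; 0; 2 * W 3 0; 2 * W 0 0]; ring.
  - by ideal_comb [:: 0; 0; - 2 * W 0 0; 2 * W 3 0]; ring.
  - by ideal_comb [:: 0; 0; 2 * W 2 0; 2 * W 1 0]; ring.
  - by ideal_comb [:: 0; 0; - 2 * W 1 0; 2 * W 2 0]; ring.
have [h01 h02 h31 h32] := mem_W_mul.
have hn : n - 1 \in I by apply: mem_ideal_gen; rewrite !inE eqxx !orbT.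
have hm : m - 1 \in I by apply: mem_ideal_gen; rewrite !inE eqxx !orbT.
case=> x1 x2.
(* Up to the norm equations, 1 is W0^2 + W1^2 + W2^2 + W3^2. As x lies in the ideal of W1, W2, the
   products W0 x and W3 x lie in I by [mem_W_mul]; the other membership of x serves for W1 x and W2
   x. *)
rewrite (_ : x = W 0 0 * (W 0 0 * x) + (W 3 0 * (W 3 0 * x)
   + (W 1 0 * (W 1 0 * x) + (W 2 0 * (W 2 0 * x) - x * (n * m - 1)))));
  last by rewrite dotp_W; ring.
have hhn h : h * (n - 1) \in I by apply: ideal_genM.
have hhm h : h * (m - 1) \in I by apply: ideal_genM.
apply: ideal_genMD; first by apply: ideal_gen_mull x1; by_gens.
apply: ideal_genMD; first by apply: ideal_gen_mull x1; by_gens.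
apply: ideal_genMD.
  by apply: ideal_gen_mull x2; by_gens => //; rewrite mulrC.
apply: ideal_genMD.
  by apply: ideal_gen_mull x2; by_gens => //; rewrite mulrC.
rewrite (_ : - (x * (n * m - 1)) = - x * m * (n - 1) + - x * (m - 1)).
  exact: ideal_genD.
by ring.
Qed.

Lemma ideal_cap_not_prime :
  W 0 0 \notin ideal_gen gens12 -> W 1 0 \notin ideal_gen gens03 ->
  ~ prime_ideal (ideal_gen gens_cap).
Proof.
move=> W0 W1 [_ IP]; have [W01 _ _ _] := mem_W_mul.
have /orP[] := IP _ _ W01; rewrite ideal_cap inE => /andP[J0 J1].
  by move/negP: W0; apply.
by move/negP: W1; apply.
Qed.

End Generators.

(** * Polynomials vanishing on a cube *)

Lemma mpoly_ring_ind (n : nat) (R : comNzRingType) (P : {mpoly R[n]} -> Prop) :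
    (forall c, P c%:MP) -> (forall i, P 'X_i) ->
    (forall p q, P p -> P q -> P (p + q)) ->
    (forall p q, P p -> P q -> P (p * q)) ->
  forall p, P p.
Proof.
move=> PC PX PD PM; apply: mpolyind; first by rewrite -mpolyC0.
move=> c m p _ _ Pp; apply: PD => //; rewrite -mul_mpolyC; apply: (PM) => //.
rewrite mpolyXE_id; apply: (big_ind P) => [|p1 p2|i _].
- by rewrite -mpolyC1.
- exact: PM.
by elim: (m i) => [|k IHk]; rewrite ?expr0 -?mpolyC1 // exprS; apply: PM.
Qed.

Lemma poly_vanish (R : realFieldType) (p : {poly R}) (e : R) :
  0 < e -> (forall t, `|t| < e -> p.[t] = 0) -> p = 0.
Proof.
move=> e0 pe; apply/eqP; apply/negPn/negP => p0.
(* The points e / (i + 2) with i < size p are distinct and, thanks to the 2, strictly below e; a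
   nonzero p has fewer roots. *)
pose r := [seq e / i.+2%:R | i <- iota 0 (size p)].
have rp : all (root p) r.
  apply/allP => _ /mapP[i _ ->]; apply/eqP/pe.
  rewrite normrM normfV !gtr0_norm ?ltr0n // ltr_pdivrMr ?ltr0n //.
  by rewrite ltr_pMr // ltr1n.
have ur : uniq r.
  rewrite map_inj_in_uniq ?iota_uniq // => i j _ _ /(mulfI (lt0r_neq0 e0)).
  by move=> /invr_inj/eqP; rewrite eqr_nat => /eqP[].
by have := max_poly_roots p0 rp ur; rewrite size_map size_iota ltnn.
Qed.

(** Induction on the number of variables: p is read as a polynomial in the last variable. Fixing the
    other variables in the cube leaves a univariate polynomial that vanishes on an interval, so all
    coefficients vanish on the smaller cube. *)
Lemma mpoly_vanish (R : realFieldType) (n : nat) (p : {mpoly R[n]}) (e : R) :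
  0 < e -> (forall v, (forall i, `|v i| < e) -> p.@[v] = 0) -> p = 0.
Proof.
move=> e0; elim: n p => [|n IHn] p pe.
  have := pe (fun=> 0); rewrite [p]nvar0_mpolyC mevalC => -> //.
  by case.
have [q pq] : exists q : {poly {mpoly R[n]}},
    p = (map_poly (@mwiden n R) q).['X_ord_max].
  elim/mpoly_ring_ind: p {pe} => [c|i|_ _ [q1 ->] [q2 ->]|_ _ [q1 ->] [q2 ->]].
  - by exists (c%:MP)%:P; rewrite map_polyC hornerC /= mwidenC.
  - case: (unliftP ord_max i) => [j|] ->; last first.
      by exists 'X; rewrite map_polyX hornerX.
    exists ('X_j)%:P; rewrite map_polyC hornerC /= mwidenX mnmwiden1.
    by congr 'X_[U_(_)]; apply: val_inj; rewrite /= /bump leqNgt ltn_ord.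
  - by exists (q1 + q2); rewrite rmorphD hornerD.
  - by exists (q1 * q2); rewrite rmorphM hornerM.
suff q0 : q = 0 by rewrite pq q0 rmorph0 horner0.
apply/polyP => k; rewrite coef0; apply: IHn => v ve.
suff: map_poly (meval v) q = 0 by move/polyP/(_ k); rewrite coef_map coef0.
apply: (poly_vanish e0) => t te.
pose V i := if unlift ord_max i is Some j then v j else t.
rewrite -(pe V) => [|i]; last by rewrite /V; case: (unlift _ _).
have VX : ('X_ord_max).@[V] = t by rewrite mevalXU /V unlift_none.
rewrite pq -VX -horner_map -map_poly_comp; congr (_.[_]).
apply: eq_map_poly => c /=.
elim/mpoly_ring_ind: c => [c|i|c d IHc IHd|c d IHc IHd].
- by rewrite mwidenC !mevalC.
- rewrite mwidenX mnmwiden1 !mevalXU /V.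
  have -> : widen_ord (leqnSn n) i = lift ord_max i.
    by apply: val_inj; rewrite /= /bump leqNgt ltn_ord.
  by rewrite liftK.
- by rewrite !raddfD /= IHc IHd.
- by rewrite !rmorphM /= IHc IHd.
Qed.

(** * Quaternion operations under ring morphisms *)

Lemma map_qmul (A B : comNzRingType) (f : {rmorphism A -> B}) (p q : 'cV[A]_4) :
  map_mx f (qmul p q) = qmul (map_mx f p) (map_mx f q).
Proof.
rewrite /qmul map_mxM; congr (_ *m _).
apply/matrixP.
by do 2!apply: forall_ord4; rewrite !mxE /= ?rmorphN ?mxE.
Qed.

Lemma map_quat (A B : comNzRingType) (f : {rmorphism A -> B}) (x0 x1 x2 x3 : A) :
  map_mx f (quat x0 x1 x2 x3) = quat (f x0) (f x1) (f x2) (f x3).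
Proof. by apply: quat_eqP; rewrite ?mxE. Qed.

Lemma map_qconj (A B : comNzRingType) (f : {rmorphism A -> B}) (p : 'cV[A]_4) :
  map_mx f (qconj p) = qconj (map_mx f p).
Proof. by rewrite map_quat !rmorphN /qconj !mxE. Qed.

Lemma map_dotp (A B : comNzRingType) (f : {rmorphism A -> B}) (n : nat)
    (v w : 'cV[A]_n) :
  f (dotp v w) = dotp (map_mx f v) (map_mx f w).
Proof.
by rewrite rmorph_sum; apply: eq_bigr => i _; rewrite rmorphM !mxE.
Qed.

(** From u W = |u|^2 z, the difference is - (|u|^2 - 1) z + u (W1 i + W2 j). *)
Lemma qmul_W_mod (A : comNzRingType) (u z : 'cV[A]_4) (i : 'I_4) :
  let W := qmul (qconj u) z in
  z i 0 - qmul u (quat (W 0 0) 0 0 (W 3 0)) i 0 \in ideal_gen (gens12 u z).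
Proof.
move: i; apply: forall_ord4 => /=.
- by ideal_comb [:: - z 0 0; 0; - u 1 0; - u 2 0]; rewrite !qE; ring.
- by ideal_comb [:: - z 1 0; 0; u 0 0; - u 3 0]; rewrite !qE; ring.
- by ideal_comb [:: - z 2 0; 0; u 3 0; u 0 0]; rewrite !qE; ring.
- by ideal_comb [:: - z 3 0; 0; - u 2 0; u 1 0]; rewrite !qE; ring.
Qed.

Lemma map_gens12 (A B : comNzRingType) (f : {rmorphism A -> B})
    (u z : 'cV[A]_4) :
  map f (gens12 u z) = gens12 (map_mx f u) (map_mx f z).
Proof.
by rewrite /gens12 /= !rmorphB !rmorph1 !map_dotp -map_qconj -map_qmul !mxE.
Qed.

(** * The vanishing ideal of the points (x, x (c + s k)) *)

Section StandardIdeal.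
Variable R : realType.
Local Notation Rab := {mpoly R[4 + 4]}.
Local Notation a := (avar R).
Local Notation b := (bvar R).
Local Notation W := (qmul (qconj a) b).
Implicit Types f g h : Rab.

Definition std_ideal : {pred Rab} := ideal_gen (gens12 a b).

Definition point (x y : 'cV[R]_4) (i : 'I_(4 + 4)) : R :=
  match split i with inl j => x j 0 | inr j => y j 0 end.

Lemma map_avar x y : map_mx (meval (point x y)) a = x.
Proof.
apply/colP => i; rewrite !mxE mevalXU /point.
by case: split_ordP => j /eqP; rewrite ?eq_lshift ?eq_lrshift // => /eqP->.
Qed.

Lemma map_bvar x y : map_mx (meval (point x y)) b = y.
Proof.
apply/colP => i; rewrite !mxE mevalXU /point.
by case: split_ordP => j /eqP; rewrite ?eq_rshift ?eq_rlshift // => /eqP->.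
Qed.

Lemma map_W x y : map_mx (meval (point x y)) W = qmul (qconj x) y.
Proof. by rewrite map_qmul map_qconj map_avar map_bvar. Qed.

Definition vanishing : {pred Rab} := [pred f |
  `[< forall x c s, dotp x x = 1 -> c ^+ 2 + s ^+ 2 = 1 ->
      f.@[point x (qmul x (quat c 0 0 s))] = 0 >]].

Lemma eval_W x c s : dotp x x = 1 ->
  map_mx (meval (point x (qmul x (quat c 0 0 s)))) W = quat c 0 0 s.
Proof.
move=> x1; rewrite map_W qmulA (_ : qmul (qconj x) x = quat 1 0 0 0).
  by apply: quat_eqP; rewrite !qE; ring.
by rewrite -x1; apply: quat_eqP; rewrite !qE; ring.
Qed.

Lemma std_ideal_vanishing f : f \in std_ideal -> f \in vanishing.
Proof.
move=> fJ; apply/asboolP => x c s x1 cs1; move: f fJ.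
pose e : {rmorphism Rab -> R} := meval (point x (qmul x (quat c 0 0 s))).
have eW : map_mx e W = quat c 0 0 s by apply: eval_W.
have eWi i : e (W i 0) = quat c 0 0 s i 0 by rewrite -eW [RHS]mxE.
rewrite -[forall f, _]/(forall f, f \in ideal_gen _ -> e f = 0).
apply: ideal_gen_ind; first exact: rmorph0.
move=> c0 g p gJ ep; rewrite rmorphD rmorphM ep addr0; move: g gJ; by_gens.
- by rewrite rmorphB rmorph1 map_dotp map_avar x1 subrr mulr0.
- rewrite rmorphB rmorph1 map_dotp map_bvar dotp_qmul x1 !qE mul1r.
  by rewrite !mul0r !addr0 -!expr2 cs1 subrr mulr0.
- by rewrite eWi quatE mulr0.
- by rewrite eWi quatE mulr0.
Qed.

(** On the set of points the coordinates a1, a2, a3, W3 are free near the origin, while a0 and W0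
    are square roots of polynomials in them; hence the normal form below has degree at most one in
    a0 and in W0. *)
Let iota : {rmorphism {mpoly R[4]} -> Rab} :=
  comp_mpoly [tuple a 1 0; a 2 0; a 3 0; W 3 0].

Let reduced A B C D : Rab :=
  iota A + iota B * a 0 0 + iota C * W 0 0 + iota D * (a 0 0 * W 0 0).

Let normal f := exists A B C D, f - reduced A B C D \in std_ideal.

Lemma normal_congr f g : f - g \in std_ideal -> normal g -> normal f.
Proof.
move=> fg [A [B [C [D gE]]]]; exists A, B, C, D.
by rewrite -(subrK g f) -addrA; apply: ideal_genD.
Qed.

Lemma normalD f g : normal f -> normal g -> normal (f + g).
Proof.
move=> [A [B [C [D fE]]]] [A' [B' [C' [D' gE]]]].
exists (A + A'), (B + B'), (C + C'), (D + D').
rewrite {1}/reduced !rmorphD.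
set x := (X in X \in _).
suff -> : x = (f - reduced A B C D) + (g - reduced A' B' C' D').
  exact: (ideal_genD fE gE).
rewrite /x /reduced; move: (iota A) (iota B) (iota C) (iota D) (W 0 0) (a 0 0) => *.
by move: (iota A') (iota B') (iota C') (iota D') => *; ring.
Qed.

Lemma normal_iota p f : normal f -> normal (iota p * f).
Proof.
move=> [A [B [C [D fE]]]]; exists (p * A), (p * B), (p * C), (p * D).
rewrite {1}/reduced !rmorphM.
set x := (X in X \in _).
suff -> : x = iota p * (f - reduced A B C D).
  exact: (ideal_genM _ fE).
rewrite /x /reduced; move: (iota p) (iota A) (iota B) (iota C) (iota D) (W 0 0) (a 0 0).
by move=> *; ring.
Qed.

Lemma iotaX (i : 'I_4) : iota 'X_i = [:: a 1 0; a 2 0; a 3 0; W 3 0]`_i.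
Proof. exact: comp_mpolyXU. Qed.

(** Modulo |a|^2 - 1 the square a0^2 is d = 1 - a1^2 - a2^2 - a3^2, so multiplication by a0
    exchanges A with B and C with D, up to factors d. *)
Lemma normal_a0 f : normal f -> normal (a 0 0 * f).
Proof.
move=> [A [B [C [D fE]]]].
pose d : {mpoly R[4]} := 1 - ('X_0 ^+ 2 + 'X_1 ^+ 2 + 'X_2 ^+ 2).
have dE : iota d = 1 - (a 1 0 ^+ 2 + a 2 0 ^+ 2 + a 3 0 ^+ 2).
  by rewrite rmorphB rmorph1 !rmorphD !rmorphXn !iotaX.
exists (d * B), A, (d * D), C.
rewrite {1}/reduced !rmorphM dE.
set x := (X in X \in _).
suff -> : x = a 0 0 * (f - reduced A B C D)
    + (iota B + iota D * W 0 0) * (dotp a a - 1).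
  apply: (ideal_genD (ideal_genM _ fE)); apply: ideal_genM.
  by apply: mem_ideal_gen; rewrite mem_head.
rewrite /x /reduced dotp4E; move: (iota A) (iota B) (iota C) (iota D) (W 0 0) => *.
by ring.
Qed.

(** The same argument with W0^2, which is 1 - W3^2 modulo the ideal. *)
Lemma normal_c f : normal f -> normal (W 0 0 * f).
Proof.
move=> [A [B [C [D fE]]]].
pose d : {mpoly R[4]} := 1 - 'X_3 ^+ 2.
have dE : iota d = 1 - W 3 0 ^+ 2.
  by rewrite rmorphB rmorph1 rmorphXn iotaX.
exists (d * C), (d * D), A, B.
rewrite {1}/reduced !rmorphM dE.
(* |W|^2 = |a|^2 |b|^2 is 1 modulo the norm equations, and W1, W2 drop out. *)
have key : W 0 0 ^+ 2 + W 3 0 ^+ 2 - 1 \in std_ideal.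
  ideal_comb [:: dotp b b; 1; - W 1 0; - W 2 0].
  by rewrite !qE; ring.
set x := (X in X \in _).
suff -> : x = W 0 0 * (f - reduced A B C D)
    + (iota C + iota D * a 0 0) * (W 0 0 ^+ 2 + W 3 0 ^+ 2 - 1).
  exact: (ideal_genD (ideal_genM _ fE) (ideal_genM _ key)).
rewrite /x /reduced; move: (iota A) (iota B) (iota C) (iota D) (W 0 0) (W 3 0) => *.
by ring.
Qed.

Lemma normal_a i f : normal f -> normal (a i 0 * f).
Proof.
move: i; apply: forall_ord4 => nf; first exact: normal_a0.
- by have := normal_iota 'X_0 nf; rewrite iotaX.
- by have := normal_iota 'X_1 nf; rewrite iotaX.
- by have := normal_iota 'X_2 nf; rewrite iotaX.
Qed.

Lemma normal_s f : normal f -> normal (W 3 0 * f).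
Proof. by move=> nf; have := normal_iota 'X_3 nf; rewrite iotaX. Qed.

Lemma normal_Z c f : normal f -> normal (c%:MP * f).
Proof.
by move=> nf; have := normal_iota c%:MP nf; rewrite [iota _]comp_mpolyC.
Qed.

Lemma normalB f g : normal f -> normal g -> normal (f - g).
Proof.
move=> nf ng; apply: normalD => //.
by rewrite -mulN1r -mpolyC1 -mpolyCN; apply: normal_Z.
Qed.

(* b = a W modulo |a|^2 - 1, where W reduces to its components 0 and 3. *)
Lemma normal_b i f : normal f -> normal (b i 0 * f).
Proof.
move=> nf.
have nac j : normal (a j 0 * (W 0 0 * f)) by apply/normal_a/normal_c.
have nas j : normal (a j 0 * (W 3 0 * f)) by apply/normal_a/normal_s.
have ab : forall i, normal ((qmul a (quat (W 0 0) 0 0 (W 3 0)) i 0) * f).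
  apply: forall_ord4; rewrite !(qmulE a) !quatE !mulr0.
  - have := normalB (nac 0) (nas 3); congr (normal _).
    by move: (W 0 0) (W 3 0) => w0 w3; ring.
  - have := normalD (nac 1) (nas 2); congr (normal _).
    by move: (W 0 0) (W 3 0) => w0 w3; ring.
  - have := normalB (nac 2) (nas 1); congr (normal _).
    by move: (W 0 0) (W 3 0) => w0 w3; ring.
  - have := normalD (nac 3) (nas 0); congr (normal _).
    by move: (W 0 0) (W 3 0) => w0 w3; ring.
apply: normal_congr (ab i).
rewrite -mulrBl mulrC; apply: ideal_genM; exact: qmul_W_mod.
Qed.

(** The constant 1 is normal, and multiplication by constants and variables preserves normality. The
    induction runs over the multiplier, so that products are handled by composition. *)
Lemma normal_all f : normal f.
Proof.
suff nM g : forall f, normal f -> normal (g * f).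
  rewrite -[f]mulr1; apply: nM; exists 1, 0, 0, 0.
  by rewrite /reduced rmorph1 !rmorph0 !mul0r !addr0 subrr ideal_gen0.
elim/mpoly_ring_ind: g => [c|i|p q IHp IHq|p q IHp IHq] {}f nf.
- exact: normal_Z.
- case: (split_ordP i) => j ->.
    by have := normal_a j nf; rewrite mxE.
  by have := normal_b j nf; rewrite mxE.
- by rewrite mulrDl; apply: normalD; [apply: IHp|apply: IHq].
- by rewrite -mulrA; apply/IHp/IHq.
Qed.

Lemma vanishing_std_ideal f : f \in vanishing -> f \in std_ideal.
Proof.
move=> /asboolP f0; have [A [B [C [D fE]]]] := normal_all f.
suff E : [/\ A = 0, B = 0, C = 0 & D = 0].
  have [A0 B0 C0 D0] := E; move: fE; rewrite A0 B0 C0 D0 /reduced !rmorph0.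
  by rewrite !mul0r !addr0 subr0.
have /asboolP nf0 := std_ideal_vanishing fE.
(* On this cube the values d and e of a0^2 and W0^2 stay positive, so every choice of signs for a0
   and W0 gives a real point. *)
have key v : (forall i, `|v i| < 2^-1) ->
    [/\ A.@[v] = 0, B.@[v] = 0, C.@[v] = 0 & D.@[v] = 0].
  move=> vi.
  have vi2 i : v i ^+ 2 < 4^-1.
    have := vi i; rewrite -(ltr_pXn2r (n := 2)) ?nnegrE ?invr_ge0 //.
    by rewrite real_normK ?num_real // => h; apply: lt_le_trans h _; lra.
  pose d := 1 - (v 0 ^+ 2 + v 1 ^+ 2 + v 2 ^+ 2).
  have d0 : 0 < d by have := vi2 0; have := vi2 1; have := vi2 2; rewrite /d; lra.
  pose e := 1 - v 3 ^+ 2.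
  have e0 : 0 < e by have := vi2 3; rewrite /e; lra.
  have ev x0 c : x0 ^+ 2 = d -> c ^+ 2 = e ->
      A.@[v] + B.@[v] * x0 + C.@[v] * c + D.@[v] * (x0 * c) = 0.
    move=> x0d ce; pose x := quat x0 (v 0) (v 1) (v 2).
    have x1 : dotp x x = 1.
      by rewrite !qE -!expr2 x0d /d; ring.
    have cs1 : c ^+ 2 + v 3 ^+ 2 = 1 by rewrite ce /e; ring.
    pose p : {rmorphism Rab -> R} := meval (point x (qmul x (quat c 0 0 (v 3)))).
    have pf : p f = 0 by apply: f0.
    have pa i : p (a i 0) = x i 0.
      by rewrite -[in RHS](map_avar x (qmul x (quat c 0 0 (v 3)))) [RHS]mxE.
    have pW i : p (W i 0) = quat c 0 0 (v 3) i 0.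
      by rewrite -[in RHS](eval_W _ _ x1) [RHS]mxE.
    have pi q : p (iota q) = q.@[v].
      rewrite [LHS]comp_mpoly_meval; apply: meval_eq; apply: forall_ord4.
      - by rewrite -[LHS]/(p (a 1 0)) pa quatE.
      - by rewrite -[LHS]/(p (a 2 0)) pa quatE.
      - by rewrite -[LHS]/(p (a 3 0)) pa quatE.
      - by rewrite -[LHS]/(p (W 3 0)) pW quatE.
    have : p (f - reduced A B C D) = 0 by apply: nf0.
    rewrite rmorphB pf sub0r => /eqP; rewrite oppr_eq0 => /eqP.
    by rewrite /reduced !rmorphD !rmorphM !pi pa pW !quatE.
  move: (A.@[v]) (B.@[v]) (C.@[v]) (D.@[v]) ev => A1 B1 C1 D1 ev.
  have [r r0 rd] : exists2 r, r != 0 & r ^+ 2 = d.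
    by exists (Num.sqrt d); rewrite ?sqr_sqrtr ?ltW // gt_eqF ?sqrtr_gt0.
  have [t t0 te] : exists2 t, t != 0 & t ^+ 2 = e.
    by exists (Num.sqrt e); rewrite ?sqr_sqrtr ?ltW // gt_eqF ?sqrtr_gt0.
  (* The four sign choices form a linear system forcing A, B r, C t and D r t to be 0, with r and t
     nonzero. *)
  have e1 := ev r t rd te.
  have e2 := ev (- r) t (etrans (sqrrN r) rd) te.
  have e3 := ev r (- t) rd (etrans (sqrrN t) te).
  have e4 := ev (- r) (- t) (etrans (sqrrN r) rd) (etrans (sqrrN t) te).
  have hA : A1 = 0 by lra.
  have hB : B1 * r = 0 by lra.
  have hC : C1 * t = 0 by lra.
  have hD : D1 * (r * t) = 0 by lra.
  split=> //; apply/eqP.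
  - by move/eqP: hB; rewrite mulf_eq0 (negPf r0) orbF.
  - by move/eqP: hC; rewrite mulf_eq0 (negPf t0) orbF.
  - by move/eqP: hD; rewrite !mulf_eq0 (negPf r0) (negPf t0) !orbF.
split; apply: (mpoly_vanish (e := 2^-1)) => [|v /key[] //]; by rewrite invr_gt0.
Qed.

End StandardIdeal.

(** * Irreducibility of the set of points *)

Lemma qmulZl (A : comNzRingType) (c : A) (p q : 'cV[A]_4) :
  qmul (c *: p) q = c *: qmul p q.
Proof. by apply: quat_eqP; rewrite [RHS]mxE !qmulE !mxE; ring. Qed.

Lemma qmulZr (A : comNzRingType) (c : A) (p q : 'cV[A]_4) :
  qmul p (c *: q) = c *: qmul p q.
Proof. by rewrite /qmul scalemxAr. Qed.

Lemma dotpZ (A : comNzRingType) (n : nat) (c : A) (v w : 'cV[A]_n) :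
  dotp (c *: v) (c *: w) = c ^+ 2 * dotp v w.
Proof.
by rewrite /dotp mulr_sumr; apply: eq_bigr => i _; rewrite !mxE; ring.
Qed.

Section Irreducibility.
Variable R : realType.
Local Notation Rab := {mpoly R[4 + 4]}.
Implicit Types f g : Rab.

(** Clearing denominators: along a rational curve with common denominator D, a power of D times f is
    a polynomial in the parameter. *)
Lemma fraction_point (n : nat) (f : {mpoly R[n]}) (N : 'I_n -> {poly R})
    (D : {poly R}) :
  exists F k, forall t, D.[t] != 0 ->
    F.[t] = D.[t] ^+ k * f.@[fun i => (N i).[t] / D.[t]].
Proof.
elim/mpoly_ring_ind: f => [c|i|p q [F [k FE]] [G [l GE]]|p q [F [k FE]] [G [l GE]]].
- by exists c%:P, 0%N => t _; rewrite hornerC mevalC mul1r.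
- by exists (N i), 1%N => t Dt; rewrite mevalXU mulrC mulfVK.
- exists (F * D ^+ l + G * D ^+ k), (k + l)%N => t Dt.
  rewrite hornerD !hornerM !horner_exp FE // GE // mevalD exprD.
  by move: (p.@[_]) (q.@[_]) (D.[t] ^+ k) (D.[t] ^+ l) => *; ring.
- exists (F * G), (k + l)%N => t Dt; rewrite hornerM FE // GE // mevalM exprD.
  by rewrite mulrACA.
Qed.

(* For x <> -1 the square of 1 + x is a positive multiple of x; the square of
   k is -1. *)
Lemma unit_quat_sqr (x : 'cV[R]_4) : dotp x x = 1 ->
  exists y, [/\ dotp y y != 0, dotp y y *: x = qmul y y
    & x 1 0 = 0 -> x 2 0 = 0 -> y 1 0 = 0 /\ y 2 0 = 0].
Proof.
rewrite !qE => x1; have [x0|x0] := eqVneq (x 0 0) (-1).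
  have [x10 x20 x30] : [/\ x 1 0 = 0, x 2 0 = 0 & x 3 0 = 0].
    move: x1; rewrite x0; move: (x 1 0) (x 2 0) (x 3 0) => r s t rst.
    have := sqr_ge0 r; have := sqr_ge0 s; have := sqr_ge0 t.
    by split; apply/eqP; rewrite -sqrf_eq0; apply/eqP; lra.
  (* Here x = -1; among its square roots k is taken because its components 1 and 2 vanish. *)
  exists (quat 0 0 0 1); split.
  - by rewrite !qE !mul0r !add0r mul1r oner_neq0.
  - by apply: quat_eqP; rewrite [LHS]mxE !qE ?x0 ?x10 ?x20 ?x30; ring.
  - by rewrite !quatE.
exists (quat (1 + x 0 0) (x 1 0) (x 2 0) (x 3 0)).
have yy : dotp (quat (1 + x 0 0) (x 1 0) (x 2 0) (x 3 0))
    (quat (1 + x 0 0) (x 1 0) (x 2 0) (x 3 0)) = 2 * (1 + x 0 0).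
  by rewrite !qE; lra.
rewrite yy; split=> [||-> ->]; rewrite ?quatE //.
  by rewrite mulf_neq0 ?pnatr_eq0 // addrC addr_eq0.
have h : x 1 0 * x 1 0 + x 2 0 * x 2 0 + x 3 0 * x 3 0 = 1 - x 0 0 * x 0 0.
  by lra.
apply: quat_eqP; rewrite [LHS]mxE !qE; try by ring.
transitivity ((1 + x 0 0) * (1 + x 0 0)
  - (x 1 0 * x 1 0 + x 2 0 * x 2 0 + x 3 0 * x 3 0)); last by ring.
by rewrite h; ring.
Qed.

Lemma not_vanishingP f : f \notin @vanishing R -> exists x c s,
  [/\ dotp x x = 1, c ^+ 2 + s ^+ 2 = 1
    & f.@[point x (qmul x (quat c 0 0 s))] != 0].
Proof.
move=> fV; apply: contrapT => h; move/negP: fV; apply.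
apply/asboolP => x c s x1 cs1; apply/eqP/negPn/negP => f0.
by apply: h; exists x, c, s.
Qed.

(** Dividing by norms removes the unit constraints: y, c, s only have to keep the denominators
    nonzero, so that parameters can be joined by lines. *)
Lemma vanishing_param f : f \notin @vanishing R ->
  exists y c s, [/\ dotp y y != 0, c ^+ 2 + s ^+ 2 != 0 &
   f.@[point ((dotp y y)^-1 *: qmul y y)
     (((dotp y y) * (c ^+ 2 + s ^+ 2))^-1 *:
        qmul (qmul y y) (qmul (quat c 0 0 s) (quat c 0 0 s)))] != 0].
Proof.
move=> /not_vanishingP[x [c [s [x1 cs1 f0]]]].
have [y [y0 yx _]] := unit_quat_sqr x1.
have cs1' : dotp (quat c 0 0 s) (quat c 0 0 s) = 1.
  by rewrite !qE -[RHS]cs1; ring.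
have [v [v0 vx]] := unit_quat_sqr cs1'.
rewrite !quatE => /(_ erefl erefl)[v1 v2].
have vE : v = quat (v 0 0) 0 0 (v 3 0).
  by apply: quat_eqP; rewrite ?quatE.
have vvE : dotp v v = v 0 0 ^+ 2 + v 3 0 ^+ 2.
  by rewrite !qE v1 v2; ring.
exists y, (v 0 0), (v 3 0); rewrite -vE -vvE; split=> //.
rewrite -yx -vx scalerA mulVf // scale1r.
by rewrite qmulZl qmulZr !scalerA mulVf ?mulf_neq0 // scale1r.
Qed.

(** A line joins the parameters of a point where f is nonzero to those of a point where g is
    nonzero. Along it f and g become fractions with numerators F and G, where F(0) and G(1) are
    nonzero. So F G is a nonzero polynomial, whereas vanishing of f g would make it zero. *)
Lemma vanishing_irreducible f g :
  f \notin @vanishing R -> g \notin @vanishing R -> f * g \notin @vanishing R.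
Proof.
move=> /vanishing_param[y [c [s [y0 cs0 fP]]]].
move=> /vanishing_param[y' [c' [s' [y0' cs0' gP]]]].
pose line (r r' : R) : {poly R} := r%:P + 'X * (r' - r)%:P.
have line0 r r' : (line r r').[0] = r.
  by rewrite hornerD hornerM hornerX !hornerC; ring.
have line1 r r' : (line r r').[1] = r'.
  by rewrite hornerD hornerM hornerX !hornerC; ring.
pose Y : 'cV[{poly R}]_4 := \col_i line (y i 0) (y' i 0).
pose C := line c c'; pose S := line s s'.
pose U := quat C 0 0 S.
pose D := dotp Y Y * (C ^+ 2 + S ^+ 2).
pose N (i : 'I_(4 + 4)) := match split i with
  | inl j => (C ^+ 2 + S ^+ 2) * qmul Y Y j 0
  | inr j => qmul (qmul Y Y) (qmul U U) j 0 end.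
pose ev t : {rmorphism {poly R} -> R} := horner_eval t.
pose yt t := map_mx (ev t) Y.
have Y0 : yt 0 = y by apply/colP => i; rewrite !mxE; exact: line0.
have Y1 : yt 1 = y' by apply/colP => i; rewrite !mxE; exact: line1.
have DE t : D.[t] = dotp (yt t) (yt t) * (C.[t] ^+ 2 + S.[t] ^+ 2).
  by rewrite -[LHS]/(ev t D) rmorphM map_dotp rmorphD !rmorphXn.
have evY t j : ev t (qmul Y Y j 0) = qmul (yt t) (yt t) j 0.
  by rewrite -map_qmul [RHS]mxE.
have evYU t j : ev t (qmul (qmul Y Y) (qmul U U) j 0) =
    qmul (qmul (yt t) (yt t))
      (qmul (quat C.[t] 0 0 S.[t]) (quat C.[t] 0 0 S.[t])) j 0.
  have <- : map_mx (ev t) U = quat C.[t] 0 0 S.[t] by rewrite map_quat rmorph0.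
  by rewrite -!map_qmul [RHS]mxE.
have NE t i : D.[t] != 0 -> (N i).[t] / D.[t] =
   point ((dotp (yt t) (yt t))^-1 *: qmul (yt t) (yt t))
     (((dotp (yt t) (yt t)) * (C.[t] ^+ 2 + S.[t] ^+ 2))^-1 *:
        qmul (qmul (yt t) (yt t))
          (qmul (quat C.[t] 0 0 S.[t]) (quat C.[t] 0 0 S.[t]))) i.
  rewrite DE mulf_eq0 negb_or => /andP[m0 n0].
  rewrite /N /point; case: split => j.
    rewrite -[X in X / _]/(ev t _) rmorphM evY rmorphD !rmorphXn [RHS]mxE.
    rewrite -[ev t C]/(C.[t]) -[ev t S]/(S.[t]).
    move: (dotp _ _) (_ ^+ 2 + _) (qmul _ _ _ _) m0 n0 => m n q m0 n0.
    by field; apply/andP.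
  by rewrite -[X in X / _]/(ev t _) evYU [RHS]mxE mulrC.
clearbody D N.
have [F [k FE]] := fraction_point f N D.
have [G [l GE]] := fraction_point g N D.
have D0 : D.[0] != 0 by rewrite DE Y0 !line0 mulf_neq0.
have D1 : D.[1] != 0 by rewrite DE Y1 !line1 mulf_neq0.
have F0 : F.[0] != 0.
  rewrite FE // mulf_neq0 ?expf_neq0 // (meval_eq _ (fun i => NE 0 i D0)).
  by rewrite Y0 !line0.
have G1 : G.[1] != 0.
  rewrite GE // mulf_neq0 ?expf_neq0 // (meval_eq _ (fun i => NE 1 i D1)).
  by rewrite Y1 !line1.
(* The factor D makes the product vanish also at those t where the parametrisation is undefined. *)
have FGD : F * G * D != 0.
  rewrite !mulf_neq0 //.
  - by apply: contraNneq F0 => ->; rewrite horner0.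
  - by apply: contraNneq G1 => ->; rewrite horner0.
  - by apply: contraNneq D0 => ->; rewrite horner0.
apply/negP => /asboolP fg0; move/negP: FGD; apply; apply/eqP.
apply: (poly_vanish ltr01) => t _; rewrite !hornerM.
have [->|Dt] := eqVneq D.[t] 0; first by rewrite mulr0.
rewrite FE // GE // !(meval_eq _ (fun i => NE t i Dt)).
rewrite mulrACA -mevalM.
move: Dt; rewrite DE mulf_eq0 negb_or => /andP[m0 n0].
move: (yt t) (C.[t]) (S.[t]) m0 n0 => z p q m0 n0.
set x := _ *: qmul z z.
(* The square of p + q k divided by p^2 + q^2 is again some c + s k with c^2 + s^2 = 1, so the point
   has the form required by [vanishing]. *)
have -> : (dotp z z * (p ^+ 2 + q ^+ 2))^-1 *:
    qmul (qmul z z) (qmul (quat p 0 0 q) (quat p 0 0 q)) =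
  qmul x (quat ((p ^+ 2 - q ^+ 2) / (p ^+ 2 + q ^+ 2)) 0 0
               (2 * p * q / (p ^+ 2 + q ^+ 2))).
  rewrite /x qmulZl invfM -scalerA; congr (_ *: _).
  rewrite -qmulZr; congr qmul.
  by apply: quat_eqP; rewrite [LHS]mxE !qE; field.
rewrite fg0 ?mulr0 ?mul0r //.
  by rewrite dotpZ dotp_qmul -expr2 -exprMn mulVf // expr1n.
by field.
Qed.

Lemma std_ideal_prime : prime_ideal (@std_ideal R).
Proof.
have sV := @std_ideal_vanishing; have Vs := @vanishing_std_ideal R.
split; first split.
- exact: ideal_gen0.
- apply/negP => /sV/asboolP/(_ (quat 1 0 0 0) 1 0).
  rewrite !qE meval1; move/(_ ltac:(ring) ltac:(ring))/eqP.
  by rewrite oner_eq0.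
- by move=> c p q pJ qJ; apply: ideal_genMD.
- move=> f g fg; apply/orP; have [fV|fV] := boolP (f \in @vanishing R).
    by left; apply: Vs.
  have [gV|gV] := boolP (g \in @vanishing R); first by right; apply: Vs.
  by have := vanishing_irreducible fV gV; rewrite sV.
Qed.

End Irreducibility.

(** * Change of variables *)

Lemma ideal_gen_map (A B : comNzRingType) (f : {rmorphism A -> B}) s x :
  x \in ideal_gen s -> f x \in ideal_gen (map f s).
Proof.
move: x; apply: (ideal_gen_ind (P := fun x => f x \in ideal_gen (map f s))).
  by rewrite rmorph0 ideal_gen0.
move=> c g p gs fp; rewrite rmorphD rmorphM; apply: ideal_genMD => //.
by apply: mem_ideal_gen; apply: map_f.
Qed.

Lemma mem_ideal_gen_map (A B : comNzRingType) (f : {rmorphism A -> B})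
    (g : {rmorphism B -> A}) (fK : cancel f g) (gK : cancel g f) s x :
  (x \in ideal_gen (map f s)) = (g x \in ideal_gen s).
Proof.
apply/idP/idP => [/(ideal_gen_map g)|/(ideal_gen_map f)]; last by rewrite gK.
by rewrite -map_comp map_id_in // => y _; exact: fK.
Qed.

Lemma prime_ideal_map (A : comNzRingType) (f g : {rmorphism A -> A})
    (fK : cancel f g) (gK : cancel g f) s :
  prime_ideal (ideal_gen s) -> prime_ideal (ideal_gen (map f s)).
Proof.
have mE x := mem_ideal_gen_map fK gK s x.
move=> [[_ s1 _] sP]; split; first split.
- exact: ideal_gen0.
- by rewrite mE rmorph1.
- by move=> c p q ps qs; apply: ideal_genMD.
- by move=> p q; rewrite !mE rmorphM => /sP.
Qed.

Lemma eq_prime_ideal (A : comNzRingType) (S T : {pred A}) :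
  S =i T -> prime_ideal T -> prime_ideal S.
Proof.
move=> ST [[T0 T1 TD] TP]; split; first split; rewrite ?ST //.
- by move=> c p q; rewrite !ST; apply: TD.
- by move=> p q; rewrite !ST; apply: TP.
Qed.

Lemma map_Rmx (A B : comNzRingType) (f : {rmorphism A -> B}) (p : 'cV[A]_4) :
  map_mx f (Rmx p) = Rmx (map_mx f p).
Proof.
apply/matrixP.
by do 2!apply: forall_ord3; rewrite [LHS]mxE !RmxE !mxE; ring.
Qed.

Lemma RmxZ (A : comNzRingType) (c : A) (p : 'cV[A]_4) :
  Rmx (c *: p) = c ^+ 2 *: Rmx p.
Proof.
apply/matrixP.
by do 2!apply: forall_ord3; rewrite [RHS]mxE !RmxE !mxE; ring.
Qed.

Definition pure (A : comNzRingType) (v : 'cV[A]_3) : 'cV[A]_4 :=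
  quat 0 (v 0 0) (v 1 0) (v 2 0).

(* R(p) v is the vector part of p v p^*. *)
Lemma Rmx_mulmx (A : comNzRingType) (p : 'cV[A]_4) (v w : 'cV[A]_3) :
  qmul p (pure v) = qmul (pure w) p -> Rmx p *m v = dotp p p *: w.
Proof.
move=> pvw; have Rp : pure (Rmx p *m v) = qmul (qmul p (pure v)) (qconj p).
  by apply: quat_eqP; rewrite !qE ?mxE ?sum_ord3 ?RmxE; ring.
have {}Rp : pure (Rmx p *m v) = dotp p p *: pure w.
  by rewrite Rp pvw -qmulA qmul_conj qmul_scalar.
apply/colP; apply: forall_ord3; rewrite [RHS]mxE.
- by move/matrixP: Rp => /(_ 1 0); rewrite [RHS]mxE !quatE.
- by move/matrixP: Rp => /(_ 2 0); rewrite [RHS]mxE !quatE.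
- by move/matrixP: Rp => /(_ 3 0); rewrite [RHS]mxE !quatE.
Qed.

(** * Rotations given by alpha and beta, and linear automorphisms of R[a, b] *)

Section Rotations.
Variable R : realType.
Local Notation Rab := {mpoly R[4 + 4]}.
Local Notation a := (avar R).
Local Notation b := (bvar R).

Lemma dotp_gt0 (p : 'cV[R]_4) : p <> 0 -> 0 < dotp p p.
Proof.
move=> p0; rewrite lt_neqAle eq_sym andbC; apply/andP; split.
  by apply: sumr_ge0 => i _; rewrite -expr2 sqr_ge0.
apply: contra_notN p0; rewrite /dotp psumr_eq0; last first.
  by move=> i _; rewrite -expr2 sqr_ge0.
move=> /allP p0; apply/colP => i; apply/eqP.
by have := p0 i; rewrite mem_index_enum mulf_eq0 orbb mxE => /(_ isT).
Qed.

Definition unitq (p : 'cV[R]_4) : 'cV[R]_4 := (Num.sqrt (dotp p p))^-1 *: p.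

Lemma dotp_unitq p : p <> 0 -> dotp (unitq p) (unitq p) = 1.
Proof.
move=> /dotp_gt0 p0; rewrite dotpZ exprVn sqr_sqrtr ?ltW // mulVf //.
exact: lt0r_neq0.
Qed.

Lemma Rmx_unitq p (v w : 'cV[R]_3) : p <> 0 ->
  qmul p (pure v) = qmul (pure w) p -> Rmx (unitq p) *m v = w.
Proof.
move=> /dotp_gt0 p0 pvw; rewrite RmxZ -scalemxAl (Rmx_mulmx pvw) scalerA.
by rewrite exprVn sqr_sqrtr ?ltW // mulVf ?scale1r // lt0r_neq0.
Qed.

Lemma evecE (j i : 'I_3) : evec R j i 0 = (i == j)%:R.
Proof. by rewrite mxE andbT. Qed.

(* alpha1 and alpha2 are multiples of the quaternion of the rotation matrix with
   columns eta, xi, eta x xi.  The identity alpha i = eta alpha is linear in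
   alpha, unlike R(alpha) e^1 = |alpha|^2 eta. *)
Lemma alpha_rot (eta xi : 'cV[R]_3) (alpha : 'cV[R]_4) :
  orthonormal2 eta xi -> alpha = alpha1 eta xi \/ alpha = alpha2 eta xi ->
  qmul alpha (pure (evec R 0)) = qmul (pure eta) alpha /\
  qmul alpha (pure (evec R 1)) = qmul (pure xi) alpha.
Proof.
rewrite /orthonormal2 !dotp3E /alpha1 /alpha2.
move=> [] hh xx hx alphaE.
pose h1 := eta 0 0; pose h2 := eta 1 0; pose h3 := eta 2 0.
pose x1 := xi 0 0; pose x2 := xi 1 0; pose x3 := xi 2 0.
pose n1 := h2 * x3 - h3 * x2; pose n2 := h3 * x1 - h1 * x3.
pose n3 := h1 * x2 - h2 * x1.
rewrite -/h1 -/h2 -/h3 -/x1 -/x2 -/x3 in hh xx hx alphaE.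
have {}alphaE :
    alpha = quat (h2 - x1) (n1 + h3) (n2 + x3) (1 + n3 - x2 - h1) \/
    alpha = quat (n1 - h3) (h2 + x1) (1 - n3 + x2 - h1) (n2 + x3).
  by case: alphaE => ->; [left|right]; apply: quat_eqP;
    rewrite !mxE /= /n1 /n2 /n3; ring.
(* Triple product expansion: (eta x xi) x eta = |eta|^2 xi - <eta, xi> eta, where |eta| = 1 and
   <eta, xi> = 0; [hx'] does the same for xi x (eta x xi). *)
have xh u v w : u * (h1 * h1 + h2 * h2 + h3 * h3)
    - v * (h1 * x1 + h2 * x2 + h3 * x3) = w -> u = w.
  by rewrite hh hx mulr1 mulr0 subr0.
have hx' u v w : u * (x1 * x1 + x2 * x2 + x3 * x3)
    - v * (h1 * x1 + h2 * x2 + h3 * x3) = w -> u = w.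
  by rewrite xx hx mulr1 mulr0 subr0.
(* n = eta x xi completes eta, xi to an oriented basis: xi = n x eta and
   eta = xi x n. *)
have nh1 : x1 = n2 * h3 - n3 * h2 by apply: (xh _ h1); rewrite /n2 /n3; ring.
have nh2 : x2 = n3 * h1 - n1 * h3 by apply: (xh _ h2); rewrite /n1 /n3; ring.
have nh3 : x3 = n1 * h2 - n2 * h1 by apply: (xh _ h3); rewrite /n1 /n2; ring.
have xn1 : h1 = x2 * n3 - x3 * n2 by apply: (hx' _ x1); rewrite /n2 /n3; ring.
have xn2 : h2 = x3 * n1 - x1 * n3 by apply: (hx' _ x2); rewrite /n1 /n3; ring.
have xn3 : h3 = x1 * n2 - x2 * n1 by apply: (hx' _ x3); rewrite /n1 /n2; ring.
have dn1 : n1 = h2 * x3 - h3 * x2 by [].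
have dn2 : n2 = h3 * x1 - h1 * x3 by [].
have dn3 : n3 = h1 * x2 - h2 * x1 by [].
have hn : h1 * n1 + h2 * n2 + h3 * n3 = 0 by rewrite /n1 /n2 /n3; ring.
have xn : x1 * n1 + x2 * n2 + x3 * n3 = 0 by rewrite /n1 /n2 /n3; ring.
clear xh hx'.
have -> : pure eta = quat 0 h1 h2 h3 by [].
have -> : pure xi = quat 0 x1 x2 x3 by [].
have -> : pure (evec R 0) = quat 0 1 0 0 by rewrite /pure !evecE.
have -> : pure (evec R 1) = quat 0 0 1 0 by rewrite /pure !evecE.
(* With the cross product opaque, the goals follow linearly from the relations above, monomials
   being taken as unknowns. *)
clearbody n1 n2 n3 h1 h2 h3 x1 x2 x3.
case: alphaE => ->; split; apply: quat_eqP; rewrite !qE; lra.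
Qed.

(** With chi read as a pure quaternion, beta = 1 - chi k. As chi^2 = -1, both sides equal k +
    chi. *)
Lemma beta_rot (chi : 'cV[R]_3) : dotp chi chi = 1 ->
  qmul (beta chi) (pure (evec R 2)) = qmul (pure chi) (beta chi).
Proof.
rewrite dotp3E /beta => c1.
have -> : pure (evec R 2) = quat 0 0 0 1 by rewrite /pure !evecE.
by apply: quat_eqP; rewrite -/(quat _ _ _ _) !qE; lra.
Qed.

(** beta can vanish only at chi = - e^3, which linear independence excludes. *)
Lemma beta_neq0 (chi : 'cV[R]_3) : free [:: chi; evec R 2] -> beta chi <> 0.
Proof.
rewrite free_cons span_seq1 => /andP[+ _] /matrixP b0; apply/negP/negPn.
have c1 : chi 0 0 = 0 by have := b0 2 0; rewrite !mxE.
have c2 : chi 1 0 = 0.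
  by have /eqP := b0 1 0; rewrite !mxE /= oppr_eq0 => /eqP.
have c3 : chi 2 0 = -1.
  by have /eqP := b0 0 0; rewrite !mxE /= addrC addr_eq0 => /eqP.
rewrite (_ : chi = -1 *: evec R 2) ?memvZ ?memv_line //.
apply/colP; apply: forall_ord3; rewrite [RHS]mxE evecE ?c1 ?c2 ?c3 /=.
- by rewrite mulr0.
- by rewrite mulr0.
- by rewrite mulr1.
Qed.

Lemma linformsE (v : 'cV[Rab]_4) (c : 'cV[R]_4) :
  linforms v c = qmul v (constv (unitq c)).
Proof.
rewrite /linforms -[X in _ *: X]/(qmul v _) -qmulZr; congr qmul.
by apply/colP => i; rewrite !mxE mpolyCM.
Qed.

Lemma constvE n (v : 'cV[R]_n) : constv v = map_mx (@mpolyC (4 + 4) R) v.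
Proof. by apply/colP => i; rewrite !mxE. Qed.

Lemma dotp_qmul_const (v : 'cV[Rab]_4) (c : 'cV[R]_4) : dotp c c = 1 ->
  dotp (qmul v (constv c)) (qmul v (constv c)) = dotp v v.
Proof. by move=> c1; rewrite dotp_qmul constvE -map_dotp c1 rmorph1 mulr1. Qed.

Lemma Rmx_mul_const (v : 'cV[Rab]_4) (c : 'cV[R]_4) (x y : 'cV[R]_3) :
  Rmx c *m x = y -> Rmx v *m constv y = Rmx (qmul v (constv c)) *m constv x.
Proof.
by move=> <-; rewrite !constvE map_mxM map_Rmx mulmxA Rmx_qmul.
Qed.

(** The substitution a -> a r, b -> b s, described by its values so that the inverse for unit r, s
    is the same kind of map with r and s conjugated. *)
Definition is_rotation (r s : 'cV[R]_4) (f : {rmorphism Rab -> Rab}) : Prop :=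
  [/\ map_mx f a = qmul a (constv r), map_mx f b = qmul b (constv s)
    & forall c, f c%:MP = c%:MP].

Lemma rotation_exists (r s : 'cV[R]_4) : exists f, is_rotation r s f.
Proof.
pose lq := [tuple match split i with
  | inl j => qmul a (constv r) j 0 | inr j => qmul b (constv s) j 0 end
  | i < 4 + 4].
exists (comp_mpoly lq); split=> [||c]; last exact: comp_mpolyC.
- apply/colP => i; rewrite [LHS]mxE mxE [LHS]comp_mpolyXU -tnth_nth tnth_mktuple.
  by case: split_ordP => j /eqP; rewrite ?eq_lshift ?eq_lrshift // => /eqP->.
- apply/colP => i; rewrite [LHS]mxE mxE [LHS]comp_mpolyXU -tnth_nth tnth_mktuple.
  by case: split_ordP => j /eqP; rewrite ?eq_rshift ?eq_rlshift // => /eqP->.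
Qed.

Lemma qmul_constA (v : 'cV[Rab]_4) (p q : 'cV[R]_4) :
  qmul (qmul v (constv p)) (constv q) = qmul v (constv (qmul p q)).
Proof. by rewrite -qmulA !constvE map_qmul. Qed.

Lemma qmul_const1 (v : 'cV[Rab]_4) : qmul v (constv (quat 1 0 0 0 : 'cV[R]_4)) = v.
Proof. by rewrite constvE map_quat rmorph0 rmorph1 qmul_scalar scale1r. Qed.

Lemma rotationK r s r' s' f g : is_rotation r s f -> is_rotation r' s' g ->
  qmul r r' = quat 1 0 0 0 -> qmul s s' = quat 1 0 0 0 -> cancel g f.
Proof.
move=> [fa fb fC] [ga gb gC] rr ss.
have fconst (v : 'cV[R]_4) : map_mx f (constv v) = constv v.
  by apply/colP => i; rewrite [LHS]mxE mxE fC.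
have fga : map_mx f (map_mx g a) = a.
  by rewrite ga map_qmul fa fconst qmul_constA rr qmul_const1.
have fgb : map_mx f (map_mx g b) = b.
  by rewrite gb map_qmul fb fconst qmul_constA ss qmul_const1.
move=> x; elim/mpoly_ring_ind: x => [c|i|p q IHp IHq|p q IHp IHq].
- by rewrite gC fC.
- case: (split_ordP i) => j ->.
    by have /colP/(_ j) := fga; rewrite !mxE.
  by have /colP/(_ j) := fgb; rewrite !mxE.
- by rewrite !rmorphD IHp IHq.
- by rewrite !rmorphM IHp IHq.
Qed.

Lemma qmul_conjl (p : 'cV[R]_4) : dotp p p = 1 -> qmul (qconj p) p = quat 1 0 0 0.
Proof. by move=> p1; rewrite -p1; apply: quat_eqP; rewrite !qE; ring. Qed.

(** The substitution by r and s is an automorphism carrying the generators of [std_ideal] to the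
    present ones, so primality transfers. *)
Lemma rotated_ideal (r s : 'cV[R]_4) : dotp r r = 1 -> dotp s s = 1 ->
  let u := qmul a (constv r) in let z := qmul b (constv s) in
  prime_ideal (ideal_gen (gens12 u z)) /\
  qmul (qconj u) z 0 0 \notin ideal_gen (gens12 u z).
Proof.
move=> r1 s1 u z.
have [f rf] := rotation_exists r s.
have [g rg] := rotation_exists (qconj r) (qconj s).
have fK : cancel f g by apply: (rotationK rg rf); apply: qmul_conjl.
have gK : cancel g f.
  by apply: (rotationK rf rg); rewrite qmul_conj ?r1 ?s1.
have [fa fb _] := rf; rewrite /u /z -fa -fb -map_gens12.
split; first exact: prime_ideal_map fK gK _ (@std_ideal_prime R).
rewrite -map_qconj -map_qmul mxE (mem_ideal_gen_map fK gK) fK.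
(* At the point with x = 1, c = 1, s = 0 the value of W0 is 1. *)
apply/negP => /std_ideal_vanishing/asboolP/(_ (quat 1 0 0 0) 1 0).
set e := quat 1 0 0 0; have e1 : dotp e e = 1 by rewrite !qE; ring.
have /matrixP/(_ 0 0) := eval_W 1 0 e1; rewrite [LHS]mxE quatE => -> /(_ e1).
rewrite expr1n expr0n addr0 => /(_ erefl)/eqP.
by rewrite oner_eq0.
Qed.

End Rotations.

Lemma dotp_delta (A : comNzRingType) (n : nat) (M : 'M[A]_n) (i j : 'I_n) :
  dotp (delta_mx i 0) (M *m delta_mx j 0) = M i j.
Proof.
rewrite /dotp (bigD1 i) //= big1 => [|k ki];
  rewrite !mxE ?eqxx ?(negPf ki) ?mul0r //.
rewrite mul1r addr0 (bigD1 j) //= big1 => [|k kj]; rewrite !mxE ?eqxx ?(negPf kj).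
  by rewrite mulr1 addr0.
by rewrite mulr0.
Qed.

(** * The ideal of W0, W3 as a rotated copy of the ideal of W1, W2 *)

Definition minus_i (A : comNzRingType) : 'cV[A]_4 := quat 0 (-1) 0 0.

Lemma map_minus_i (A B : comNzRingType) (f : {rmorphism A -> B}) :
  map_mx f (minus_i A) = minus_i B.
Proof. by rewrite map_quat rmorphN1 rmorph0. Qed.

Lemma dotp_minus_i (A : comNzRingType) : dotp (minus_i A) (minus_i A) = 1.
Proof. by rewrite !qE; ring. Qed.

Lemma qmul_minus_i (A : comNzRingType) (p : 'cV[A]_4) :
  qmul p (minus_i A) = quat (p 1 0) (- p 0 0) (- p 3 0) (p 2 0).
Proof. by apply: quat_eqP; rewrite !qE; ring. Qed.

(* Right multiplication of z by - i turns (W0, W3) into (- W2', W1'), up to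
   sign the pair of components in gens12. *)
Lemma ideal_gens12_minus_i (A : comNzRingType) (u z : 'cV[A]_4) :
  ideal_gen (gens03 u z) =i ideal_gen (gens12 u (qmul z (minus_i A))).
Proof.
rewrite /gens12 /gens03 qmulA (qmul_minus_i (qmul _ z)) !quatE dotp_qmul.
rewrite dotp_minus_i mulr1.
move: (qmul _ _) (dotp _ _ - 1) (dotp _ _ - 1) => W n m.
apply: ideal_gen_eq; by_gens;
  try by apply: mem_ideal_gen; rewrite !inE eqxx ?orbT.
- by ideal_comb [:: 0; 0; -1; 0 : A]; ring.
- by ideal_comb [:: 0; 0; 0; -1 : A]; ring.
- by ideal_comb [:: 0; 0; -1; 0 : A]; ring.
- by ideal_comb [:: 0; 0; 0; -1 : A]; ring.
Qed.

Lemma qmul_minus_i0 (A : comNzRingType) (u z : 'cV[A]_4) :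
  qmul u (qmul z (minus_i A)) 0 0 = qmul u z 1 0.
Proof. by rewrite qmulA qmul_minus_i quatE. Qed.

(** * The ideals of the theorem in terms of u and z *)

Section Assembly.
Variable R : realType.
Local Notation Rab := {mpoly R[4 + 4]}.
Implicit Types (v w : 'cV[Rab]_4) (r s : 'cV[R]_4).

(** This lets the norm generators in a and b be rewritten in u and z. *)
Lemma dotp_linforms v r : r <> 0 ->
  dotp (linforms v r) (linforms v r) = dotp v v.
Proof. by move=> r0; rewrite linformsE dotp_qmul_const ?dotp_unitq. Qed.

Lemma linforms_Iab1 (alpha : 'cV[R]_4) (chi : 'cV[R]_3) :
    alpha <> 0 -> beta chi <> 0 ->
  Iab1 alpha chi =i ideal_gen
    (gens12 (linforms (avar R) alpha) (linforms (bvar R) (beta chi))).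
Proof.
move=> a0 b0 x; rewrite /Iab1.
have := dotp_linforms (bvar R) b0; have := dotp_linforms (avar R) a0.
move: (linforms _ _) (linforms _ _) => z u uN zN.
by rewrite -ideal_k1 uN zN.
Qed.

Lemma linforms_Iab2 (alpha : 'cV[R]_4) (chi : 'cV[R]_3) :
    alpha <> 0 -> beta chi <> 0 ->
  Iab2 alpha chi =i ideal_gen
    (gens03 (linforms (avar R) alpha) (linforms (bvar R) (beta chi))).
Proof.
move=> a0 b0 x; rewrite /Iab2.
have := dotp_linforms (bvar R) b0; have := dotp_linforms (avar R) a0.
move: (linforms _ _) (linforms _ _) => z u uN zN.
by rewrite -ideal_k2 uN zN.
Qed.

(** The unit multiple of r rotates e^i to x, hence R(v) x = R(v r / |r|) e^i, and likewise for y;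
    the inner product of two such images is an entry of R(u^* z). *)
Lemma dotp_Rmx_linforms v w (r s : 'cV[R]_4) (x y : 'cV[R]_3) (i j : 'I_3) :
    r <> 0 -> s <> 0 ->
    qmul r (pure (evec R i)) = qmul (pure x) r ->
    qmul s (pure (evec R j)) = qmul (pure y) s ->
  dotp (Rmx v *m constv x) (Rmx w *m constv y) =
  Rmx (qmul (qconj (linforms v r)) (linforms w s)) i j.
Proof.
move=> r0 s0 rx sy; have e_const k : constv (evec R k) = delta_mx k 0.
  by apply/colP => l; rewrite !mxE; case: (_ && _).
rewrite (Rmx_mul_const v (Rmx_unitq r0 rx)) (Rmx_mul_const w (Rmx_unitq s0 sy)).
by rewrite -!linformsE !e_const dotp_Rmx dotp_delta.
Qed.

Lemma linforms_Iab (alpha : 'cV[R]_4) (eta xi chi : 'cV[R]_3) :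
    alpha <> 0 -> beta chi <> 0 ->
    qmul alpha (pure (evec R 0)) = qmul (pure eta) alpha ->
    qmul alpha (pure (evec R 1)) = qmul (pure xi) alpha ->
    qmul (beta chi) (pure (evec R 2)) = qmul (pure chi) (beta chi) ->
  Iab eta xi chi =i ideal_gen
    (gens_cap (linforms (avar R) alpha) (linforms (bvar R) (beta chi))).
Proof.
move=> a0 b0 a1 a2 b3 x.
rewrite /Iab (dotp_Rmx_linforms _ _ a0 b0 a1 b3).
rewrite (dotp_Rmx_linforms _ _ a0 b0 a2 b3).
have := dotp_linforms (bvar R) b0; have := dotp_linforms (avar R) a0.
move: (linforms _ _) (linforms _ _) => z u uN zN.
by rewrite /gens_cap uN zN.
Qed.

(** [rotated_ideal] is applied with s replaced by its product with - i, which turns W1 into the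
    component 0. *)
Lemma rotated_ideal_i r s : dotp r r = 1 -> dotp s s = 1 ->
  let u := qmul (avar R) (constv r) in let z := qmul (bvar R) (constv s) in
  prime_ideal (ideal_gen (gens03 u z)) /\
  qmul (qconj u) z 1 0 \notin ideal_gen (gens03 u z).
Proof.
move=> r1 s1.
have s'1 : dotp (qmul s (minus_i R)) (qmul s (minus_i R)) = 1.
  by rewrite dotp_qmul s1 dotp_minus_i mulr1.
have := rotated_ideal r1 s'1; rewrite -qmul_constA (constvE (minus_i R)).
rewrite map_minus_i; cbv zeta.
move: (qmul (avar R) _) (qmul (bvar R) _) => u z; rewrite qmul_minus_i0 => -[P W1].
split; last by rewrite ideal_gens12_minus_i.
exact: (eq_prime_ideal (ideal_gens12_minus_i u z) P).
Qed.

End Assembly.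

Theorem mainTheorem1 (R : realType) (eta xi chi : 'cV[R]_3) (alpha : 'cV[R]_4)
    (heta_xi : orthonormal2 eta xi)
    (heta : eta \notin <<[:: evec R 0%R; evec R 1%R]>>%VS)
    (hchi1 : dotp chi chi = 1)
    (hchi : free [:: chi; evec R 2])
    (halpha : alpha = alpha1 eta xi \/ alpha = alpha2 eta xi)
    (halpha0 : alpha <> 0) :
  [/\ prime_ideal (Iab1 alpha chi),
      prime_ideal (Iab2 alpha chi),
      Iab eta xi chi =i [predI Iab1 alpha chi & Iab2 alpha chi]
    & ~ prime_ideal (Iab eta xi chi)].
Proof.
have beta0 := beta_neq0 hchi.
have r1 := dotp_unitq halpha0; have s1 := dotp_unitq beta0.
have I1E := linforms_Iab1 halpha0 beta0; have I2E := linforms_Iab2 halpha0 beta0.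
have [P1 W0] := rotated_ideal r1 s1; have [P2 W1] := rotated_ideal_i r1 s1.
rewrite -!linformsE in P1 W0 P2 W1.
have [a1 a2] := alpha_rot heta_xi halpha; have b3 := beta_rot hchi1.
have IE := linforms_Iab halpha0 beta0 a1 a2 b3.
have half2 : (2^-1)%:MP * 2 = 1 :> {mpoly R[4 + 4]}.
  rewrite -(rmorph_nat (@mpolyC (4 + 4) R)) -mpolyCM mulVf ?mpolyC1 //.
  by rewrite pnatr_eq0.
move: (linforms _ _) (linforms _ _) IE I1E I2E P1 W0 P2 W1.
move=> z u IE I1E I2E P1 W0 P2 W1; split.
- exact: (eq_prime_ideal I1E P1).
- exact: (eq_prime_ideal I2E P2).
- apply: eq_mem_predI I1E I2E => x; rewrite IE.
  exact: (ideal_cap u z half2 x).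
- move=> P; apply: (ideal_cap_not_prime half2 W0 W1).
  exact: (eq_prime_ideal (fun x => esym (IE x)) P).
Qed.
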